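(* For every integer $n\ge 2$, $r_3(4, P_n) < 6nm$, where $m= r(P_n^2, P_n^2)$.
   Context: The 3-uniform tight path $P_n$ has vertices $v_1<\cdots<v_n$ and edges $\{v_j,v_{j+1},v_{j+2}\}$ for $j=1,\dots,n-2$; in a red/blue coloring of the 3-subsets of $[N]$, a blue copy of $P_n$ is a sequence $x_1<\cdots<x_n$ in $[N]$ with every triple $\{x_j,x_{j+1},x_{j+2}\}$ blue. $r_3(4,P_n)$ is the minimum $N$ such that every red/blue coloring of the 3-subsets of $[N]$ contains either 4 vertices all of whose triples are red or a blue copy of $P_n$. The graph $P_n^2$ is the ordered graph on $v_1<\cdots<v_n$ with edges $v_iv_j$ for $1\le|i-j|\le 2$; $r(P_n^2,P_n^2)$ is the minimum $N$ such that every red/blue coloring of the edges of the complete graph on $[N]$ contains vertices $x_1<\cdots<x_n$ with all pairs $x_ix_j$, $1\le |i-j|\le 2$, of the same color. *)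

(* Defs.v *)
From mathcomp Require Import all_boot.

Set Implicit Arguments.
Unset Strict Implicit.
Unset Printing Implicit Defensive.

(* The vertex set [N] is 'I_N.  A red/blue coloring of the k-subsets of [N] is
   given by c : {set 'I_N} -> bool, with true standing for red and false for
   blue; the values of c on sets of cardinality other than k are never used. *)

Definition increasing n N (x : 'I_n -> 'I_N) : Prop :=
  forall i j : 'I_n, i < j -> x i < x j.

Definition red_clique3 s N (c : {set 'I_N} -> bool) : Prop :=
  exists A : {set 'I_N}, #|A| = s /\
    forall e : {set 'I_N}, e \subset A -> #|e| = 3 -> c e = true.

Definition blue_tight_path n N (c : {set 'I_N} -> bool) : Prop :=
  exists x : 'I_n -> 'I_N, increasing x /\
    forall i j k : 'I_n, j = i + 1 :> nat -> k = i + 2 :> nat ->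
      c [set x i; x j; x k] = false.

(* The edges of the square of the path are the pairs of distinct vertices at
   distance at most 2; each is listed once, as v_i v_j with i < j. *)
Definition mono_path_square n N (c : {set 'I_N} -> bool) : Prop :=
  exists (b : bool) (x : 'I_n -> 'I_N), increasing x /\
    forall i j : 'I_n, i < j <= i + 2 -> c [set x i; x j] = b.

Definition is_minimum (P : nat -> Prop) (N : nat) : Prop :=
  P N /\ forall M, P M -> N <= M.

(* A Ramsey number is given by the relation it satisfies: [is_r3 s n N] says
   r_3(s, P_n) = N, and [is_r_path_square n m] says r(P_n^2, P_n^2) = m. *)
Definition is_r3 s n : nat -> Prop :=
  is_minimum (fun N => forall c : {set 'I_N} -> bool,
    red_clique3 s c \/ blue_tight_path n c).

Definition is_r_path_square n : nat -> Prop :=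
  is_minimum (fun N => forall c : {set 'I_N} -> bool, mono_path_square n c).

(* Main.v *)
Require Import Defs.
From mathcomp Require Import all_boot.
From mathcomp Require Import zify.
From Stdlib Require Import Classical.

Set Implicit Arguments.
Unset Strict Implicit.
Unset Printing Implicit Defensive.

(** Say that [(u, v)] has height at least [k] if some blue tight path on
    [k + 2] vertices ends with [u, v].  If the height of [(t, u)] is at least
    that of [(u, v)], then [tuv] is red.  Without a red 4-clique, a path square
    whose edges all lie in the red link of one vertex [z] is a blue tight path:
    a red triple of consecutive vertices would form a red 4-clique with [z].

    Suppose [v < X < w] with [#|X| >= m], all pairs [(v, x)] of height at least
    [a] and all pairs [(x, w)] of height at most [a].  For [x < y] in [X], the
    triple [vxy] is red if [(x, y)] has height at most [a], and [xyw] is red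
    otherwise, so a monochromatic path square in this 2-coloring of the pairs
    of [X] yields a blue [P_n].

    Hence heights grow along blocks of [4m] consecutive vertices: if at least
    [2m] vertices [x] of a block satisfy that [(v, x)] has height at least [a],
    then either one of them has [2m] successors in the next block at height at
    least [a + 1], or by double counting some [w] in the next block is at
    height at most [a] from at least [m] of them, and [X] exists.  After
    [n - 2] blocks this gives a blue [P_n]. *)

(** * Existence of the Ramsey numbers *)

Lemma is_minimum_exists (P : nat -> Prop) :
  (exists N, P N) -> exists N, is_minimum P N.
Proof.
case=> N; elim/ltn_ind: N => N IHN PN.
case: (classic (exists2 M, M < N & P M)) => [[M /IHN]|minN]; first exact.
exists N; split=> // M PM; rewrite leqNgt; apply/negP=> ltMN.
by case: minN; exists M.
Qed.

Definition homogeneous (T : finType) (c : {set T} -> bool) b s (B : {set T}) :=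
  #|B| = s /\ {in B &, forall x y, x != y -> c [set x; y] = b}.

Lemma homogeneous_add (T : finType) (c : {set T} -> bool) b s (B : {set T}) x :
  homogeneous c b s B -> x \notin B -> {in B, forall y, c [set x; y] = b} ->
  homogeneous c b s.+1 (x |: B).
Proof.
move=> [sB cB] xB cx; split=> [|y z]; first by rewrite cardsU1 xB sB.
rewrite !in_setU1; case: (eqVneq y x) => [->|_]; case: (eqVneq z x) => [->|_] //=.
- by move=> _ zB _; apply: cx.
- by move=> yB _ _; rewrite setUC; apply: cx.
- by move=> yB zB; apply: cB.
Qed.

(** Induction on [s], then on [t]: any vertex [x] of [A] has [N1] neighbours of color [true] or [N2]
    of color [false] in [A]. Ranging over subsets [A] lets the induction hypotheses be applied
    inside these neighbourhoods. *)
Lemma graph_ramsey s t : exists N,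
  forall (T : finType) (c : {set T} -> bool) (A : {set T}), N <= #|A| ->
  exists2 B : {set T}, B \subset A &
    homogeneous c true s B \/ homogeneous c false t B.
Proof.
elim: s t => [|s IHs] t.
  exists 0 => T c A _; exists set0; first exact: sub0set.
  by left; split=> [|x y]; rewrite ?cards0 // inE.
elim: t => [|t [N2 IHt]].
  exists 0 => T c A _; exists set0; first exact: sub0set.
  by right; split=> [|x y]; rewrite ?cards0 // inE.
have [N1 {}IHs] := IHs t.+1.
exists (N1 + N2).+1 => T c A leNA.
have /card_gt0P[x xA] : 0 < #|A| by exact: leq_trans leNA.
pose A' := A :\ x; pose R := [set y | c [set x; y]].
have sub (B C : {set T}) : B \subset A' :&: C ->
    (x |: B \subset A) * (x \notin B) * (B \subset A).
  rewrite subsetI => /andP[/subsetP BA' _].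
  have BA : B \subset A by apply/subsetP=> y /BA' /setD1P[].
  split=> //; split; first by rewrite subUset sub1set xA.
  by apply/negP=> /BA'; rewrite !inE eqxx.
have cardA : #|A' :&: R| + #|A' :\: R| = #|A|.-1.
  by rewrite cardsID (cardsD1 x A) xA.
have [leN1|ltN1] := leqP N1 #|A' :&: R|.
  have [B BA hB] := IHs T c _ leN1; have [[xBA xB] BA'] := sub _ _ BA.
  case: hB => hB; [exists (x |: B) => //; left|by exists B => //; right].
  apply: homogeneous_add hB xB _ => y /(subsetP BA).
  by rewrite !inE => /andP[].
have leN2 : N2 <= #|A' :\: R| by lia.
have [B BA hB] := IHt T c _ leN2.
rewrite setDE in BA; have [[xBA xB] BA'] := sub _ _ BA.
case: hB => hB; [by exists B => //; left|exists (x |: B) => //; right].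
apply: homogeneous_add hB xB _ => y /(subsetP BA).
by rewrite !inE => /andP[_ /negbTE].
Qed.

Lemma increasing_enum s N (A : {set 'I_N}) : s <= #|A| ->
  exists2 e : 'I_s -> 'I_N, increasing e & forall i, e i \in A.
Proof.
move=> leA; exists (fun i => enum_val (widen_ord leA i)); last by move=> i; apply: enum_valP.
move=> i j ltij; have x0 := enum_val (widen_ord leA i).
rewrite !(enum_val_nth x0) /=.
have srt : sorted ltn (map val (enum A)).
  apply: (subseq_sorted ltn_trans) (iota_ltn_sorted 0 N).
  by rewrite -val_enum_ord map_subseq // enumT; apply: filter_subseq.
have szj : j < size (enum A) by rewrite -cardE; apply: leq_trans leA.
have szi : i < size (enum A) by apply: ltn_trans szj.
have := sorted_ltn_nth ltn_trans 0 srt; move/(_ i j).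
rewrite !inE size_map => /(_ szi szj ltij).
by rewrite !(nth_map x0).
Qed.

Lemma increasing_lt n N (x : 'I_n -> 'I_N) (i j : 'I_n) :
  increasing x -> i < j -> x i != x j.
Proof. by move=> incx ltij; rewrite -val_eqE neq_ltn incx. Qed.

Lemma mono_path_square_exists n :
  exists N, forall c : {set 'I_N} -> bool, mono_path_square n c.
Proof.
have [N RN] := graph_ramsey n n; exists N => c.
have [|B _ hB] := RN _ c [set: 'I_N]; first by rewrite cardsT card_ord.
have {hB}[b [/eqP sB cB]] : exists b, homogeneous c b n B.
  by case: hB; [exists true|exists false].
have [e ince eB] := increasing_enum (eq_leq (esym (eqP sB))).
exists b, e; split=> // i j /andP[ltij _].
by apply: cB => //; apply: increasing_lt.
Qed.

Lemma mono_path_square_on n m N (r : rel 'I_N) (X : {set 'I_N}) :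
  (forall c : {set 'I_m} -> bool, mono_path_square n c) -> m <= #|X| ->
  exists (b : bool) (y : 'I_n -> 'I_N),
    [/\ increasing y, forall i, y i \in X &
      forall i j : 'I_n, i < j <= i + 2 -> r (y i) (y j) = b].
Proof.
move=> Rm /increasing_enum[e ince eX].
(* The relation [r] need not be symmetric, so the coloring reads an unordered pair in increasing
   order. *)
have [b [x [incx cx]]] := Rm (fun S : {set 'I_m} =>
  [exists i in S, exists j in S, (i < j) && r (e i) (e j)]).
exists b, (e \o x); split=> [i j /incx /ince //|i|i j ij]; first exact: eX.
have := cx i j ij; have /andP[/incx ltx _] := ij => <-.
apply/idP/'exists_andP => /= [rij|].
  exists (x i); rewrite !inE eqxx /=; split=> //; apply/existsP; exists (x j).
  by rewrite !inE eqxx orbT ltx.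
case=> u [uS /'exists_andP[v [vS /andP[ltuv]]]].
by move: uS vS ltuv; rewrite !inE => /orP[]/eqP-> /orP[]/eqP->; rewrite ?ltnn //; lia.
Qed.

(** * Red 4-cliques and red links *)

Lemma red_clique4 N (c : {set 'I_N} -> bool) x y z t :
  uniq [:: x; y; z; t] ->
  c [set x; y; z] -> c [set x; y; t] -> c [set x; z; t] -> c [set y; z; t] ->
  red_clique3 4 c.
Proof.
move=> Uxyzt c1 c2 c3 c4; pose A := [set w in [:: x; y; z; t]].
have cA : #|A| = 4 by rewrite cardsE; apply/card_uniqP.
exists A; split=> // e eA ce.
(* A triple in [A] omits exactly one vertex [u], which leaves four cases. *)
have /eqP/cards1P[u Du] : #|A :\: e| = 1.
  by have := cardsID e A; rewrite (setIidPr eA) cA ce => -[].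
have De : e = A :\ u by rewrite -Du setDDr setDv set0U (setIidPr eA).
have uA : u \in A by have := set11 u; rewrite -Du => /setDP[].
have E p q r : A :\ u =i [set p; q; r] -> c [set p; q; r] -> c e = true.
  by move=> /setP Eu; rewrite De Eu.
move: Uxyzt uA; rewrite /= !inE !negb_or -!andbA.
move=> /and5P[xy xz xt yz /and3P[yt zt _]].
case/or4P=> /eqP Eu; [apply: E c4|apply: E c3|apply: E c2|apply: E c1] => w;
  rewrite Eu !inE -!orbA.
- by case: eqVneq => // ->; rewrite (negbTE xy) (negbTE xz) (negbTE xt).
- by case: (eqVneq w y) => // ->; rewrite eq_sym (negbTE xy) (negbTE yz) (negbTE yt).
- by case: (eqVneq w z) => // ->; rewrite eq_sym (negbTE xz) eq_sym (negbTE yz) (negbTE zt).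
- case: (eqVneq w t) => [->|_]; rewrite ?orbF //.
  by rewrite eq_sym (negbTE xt) eq_sym (negbTE yt) eq_sym (negbTE zt).
Qed.

Lemma red_link_path n N (c : {set 'I_N} -> bool) z (y : 'I_n -> 'I_N) :
  ~ red_clique3 4 c -> increasing y -> (forall i, z != y i) ->
  (forall i j : 'I_n, i < j <= i + 2 -> c [set z; y i; y j]) ->
  blue_tight_path n c.
Proof.
move=> noRed incy zy cz; exists y; split=> // i j k ij ik.
apply/negP=> cijk; apply: noRed.
apply: (red_clique4 (x := z) (y := y i) (z := y j) (t := y k)) => //.
- by rewrite /= !inE !negb_or !zy !increasing_lt //; lia.
- by apply: cz; lia.
- by apply: cz; lia.
- by apply: cz; lia.
Qed.

(** * Heights of pairs: [ends_blue_path c k u v] is height at least [k] *)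

Fixpoint ends_blue_path N (c : {set 'I_N} -> bool) k (u v : 'I_N) : bool :=
  if k is k'.+1 then
    (u < v) && [exists t, ends_blue_path c k' t u && ~~ c [set t; u; v]]
  else u < v.

Lemma ends_blue_path_lt N (c : {set 'I_N} -> bool) k u v :
  ends_blue_path c k u v -> u < v.
Proof. by case: k => [|k] //= /andP[]. Qed.

Lemma ends_blue_path_pred N (c : {set 'I_N} -> bool) k u v :
  ends_blue_path c k.+1 u v -> ends_blue_path c k u v.
Proof.
elim: k u v => [|k IHk] u v; first exact: ends_blue_path_lt.
case/andP=> ltuv /existsP[t /andP[/IHk tu ct]]; rewrite /= ltuv.
by apply/existsP; exists t; apply/andP.
Qed.

Lemma ends_blue_path_red N (c : {set 'I_N} -> bool) k (t u v : 'I_N) :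
  ends_blue_path c k t u -> u < v -> ~~ ends_blue_path c k.+1 u v -> c [set t; u; v].
Proof.
move=> tu ltuv; apply: contraNT => ct /=; rewrite ltuv.
by apply/existsP; exists t; apply/andP.
Qed.

Lemma ends_blue_path_tight N (c : {set 'I_N} -> bool) k u v :
  ends_blue_path c k u v -> blue_tight_path k.+2 c.
Proof.
(* Indexing the path by [nat] avoids casts between ordinal types in the induction; only the values
   up to [k.+1] matter. *)
move=> kuv; suff [x [xlt xc _ _]] : exists x : nat -> 'I_N,
    [/\ forall i, i <= k -> x i < x i.+1,
        forall i, i < k -> c [set x i; x i.+1; x i.+2] = false, x k = u & x k.+1 = v].
  exists (fun i : 'I_k.+2 => x i); split=> [i j ltij|i j l ij il].
    suff : {in [pred l | l < k.+2] &, {homo x : a b / a < b >-> a < b}}.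
      by apply=> //; apply: ltn_ord.
    apply: homo_ltn_in => [y w z|a b ha hb l /andP[_ ltlb]|a _ /ltnSE/ltnSE/xlt//].
      exact: ltn_trans.
    exact: ltn_trans ltlb hb.
  by rewrite ij il addn1 addn2 xc //; have := ltn_ord l; lia.
elim: k u v kuv => [|k IHk] u v /=.
  by move=> ltuv; exists (fun i => if i is 0 then u else v); split=> // -[].
case/andP=> ltuv /existsP[t /andP[/IHk[x [xlt xc xt xu]] ct]].
exists (fun i => if i <= k.+1 then x i else v); split=> [i lei|i lti||].
- case: (ltnP i k.+1) => [lt|ge]; first by rewrite (ltnW lt) xlt.
  have -> : i = k.+1 by lia.
  by rewrite leqnn xu.
- case: (ltnP i k) => [lt|ge]; first by rewrite !ifT ?xc //; lia.
  have ->: i = k by lia.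
  by rewrite leqnSn leqnn xt xu ltnn; apply/negbTE.
- by rewrite leqnn.
- by rewrite ltnn.
Qed.

Arguments ends_blue_path : simpl never.

(** * Double counting between two vertex sets *)

Lemma card_setId_compl (T : finType) (P : pred T) (B : {set T}) :
  #|[set w in B | P w]| + #|[set w in B | ~~ P w]| = #|B|.
Proof.
rewrite -(cardsID [set w | P w] B).
by congr (_ + _); apply: eq_card => w; rewrite !inE // andbC.
Qed.

Lemma dense_column (T : finType) (r : rel T) (X B : {set T}) : 0 < #|B| ->
  {in X, forall x, #|B| <= 2 * #|[set w in B | r x w]|} ->
  exists2 w, w \in B & #|X| <= 2 * #|[set x in X | r x w]|.
Proof.
move=> B0 dX; case: (pickP [pred w in B | #|X| <= 2 * #|[set x in X | r x w]|]).
  by move=> w /andP[]; exists w.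
move=> noW; suff : #|B| * #|X| < #|X| * #|B| by rewrite mulnC ltnn.
have E1 : \sum_(x in X) #|[set w in B | r x w]| = \sum_(w in B) #|[set x in X | r x w]|.
  under eq_bigr do rewrite -sum1dep_card big_mkcondr.
  rewrite exchange_big /=; apply: eq_bigr => w _.
  by rewrite -sum1dep_card big_mkcondr.
have : \sum_(x in X) #|B| <= 2 * \sum_(x in X) #|[set w in B | r x w]|.
  by rewrite big_distrr; apply: leq_sum.
rewrite E1 big_distrr sum_nat_const /= => /leq_ltn_trans.
rewrite (mulnC #|B|); apply; rewrite mulnC -sum_nat_const.
(* Every column is less than half full; one column [w0] is split off to make the inequality between
   the sums strict. *)
have {B0} /card_gt0P[w0 w0B] := B0.
rewrite [ltnRHS](bigD1 w0) // [ltnLHS](bigD1 w0) //= -addSn.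
have lt w : w \in B -> 2 * #|[set x in X | r x w]| < #|X|.
  by move=> wB; have /= := noW w; rewrite wB leqNgt => /negbFE.
by apply: leq_add; [apply: lt|apply: leq_sum => w /andP[/lt/ltnW]].
Qed.

(** If every row has fewer than [2 * k] of the [4 * k] entries, the complement of [r] fills at least
    half of each row, hence at least half of some column. *)
Lemma heavy_row_or_light_column (T : finType) (r : rel T) (X B : {set T}) k :
  0 < k -> 2 * k <= #|X| -> #|B| = 4 * k ->
  (exists2 x, x \in X & 2 * k <= #|[set w in B | r x w]|) \/
  (exists2 w, w \in B & k <= #|[set x in X | ~~ r x w]|).
Proof.
move=> k0 leX cB; case: (pickP [pred x in X | 2 * k <= #|[set w in B | r x w]|]).
  by move=> x /andP[xX lex]; left; exists x.
move=> noX; right.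
have [||w wB lew] := @dense_column _ (fun x w => ~~ r x w) X B; first by lia.
  move=> x xX; have := noX x; rewrite /= xX leqNgt => /negbFE.
  by have := card_setId_compl (r x) B; rewrite cB; lia.
by exists w => //; move: lew; rewrite /=; lia.
Qed.

Lemma card_ord_interval N a b : b <= N -> #|[set w : 'I_N | a <= w < b]| = b - a.
Proof.
move=> leb; rewrite -sum1dep_card -[RHS]muln1 -sum_nat_const_nat.
by rewrite (@big_nat_widenl _ _ _ a 0) // (big_nat_widen 0 b N) // big_mkord.
Qed.

(** * Growth of heights along blocks *)

Lemma red_link_dichotomy n m N (c : {set 'I_N} -> bool) a (v w : 'I_N) (X : {set 'I_N}) :
  (forall c' : {set 'I_m} -> bool, mono_path_square n c') -> m <= #|X| ->
  ~ red_clique3 4 c ->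
  {in X, forall x, ends_blue_path c a v x} ->
  {in X, forall x : 'I_N, x < w /\ ~~ ends_blue_path c a.+1 x w} ->
  blue_tight_path n c.
Proof.
move=> Rm leX noRed vX Xw.
have [b [y [incy yX ry]]] := mono_path_square_on (ends_blue_path c a.+1) Rm leX.
case: b ry => ry.
  (* The edges of the path square have height at least [a.+1], so they lie in the red link of
     [w]. *)
  apply: (@red_link_path _ _ _ w y) => // [i|i j ij].
    by have [] := Xw _ (yX i); rewrite -val_eqE neq_ltn => ->; rewrite orbT.
  have [ltjw njw] := Xw _ (yX j).
  rewrite -setUA setUC; apply: (ends_blue_path_red (ry i j ij) ltjw).
  by apply: contraNN njw => /ends_blue_path_pred.
(* Here the edges have height at most [a], so they lie in the red link of [v]. *)
apply: (@red_link_path _ _ _ v y) => // [i|i j ij].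
  by have /ends_blue_path_lt := vX _ (yX i); rewrite -val_eqE neq_ltn => ->.
have /andP[ltij _] := ij.
by apply: (ends_blue_path_red (vX _ (yX i)) (incy _ _ ltij)); rewrite ry.
Qed.

Lemma blue_path_extension n m N (c : {set 'I_N} -> bool) a v (X B : {set 'I_N}) :
  (forall c' : {set 'I_m} -> bool, mono_path_square n c') -> 0 < m ->
  ~ red_clique3 4 c -> ~ blue_tight_path n c ->
  2 * m <= #|X| -> #|B| = 4 * m -> {in X & B, forall x w : 'I_N, x < w} ->
  {in X, forall x, ends_blue_path c a v x} ->
  exists2 x, x \in X & 2 * m <= #|[set w in B | ends_blue_path c a.+1 x w]|.
Proof.
move=> Rm m0 noRed noBlue leX cB ltXB vX.
have [//|[w wB lew]] := heavy_row_or_light_column (ends_blue_path c a.+1) m0 leX cB.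
case: noBlue.
apply: (red_link_dichotomy (v := v) (w := w) Rm lew) => //.
- by move=> x /setIdP[xX _]; apply: vX.
- by move=> x /setIdP[xX nxw]; split=> //; apply: ltXB.
Qed.

Lemma long_blue_paths n m N (c : {set 'I_N} -> bool) a :
  (forall c' : {set 'I_m} -> bool, mono_path_square n c') -> 0 < m ->
  ~ red_clique3 4 c -> ~ blue_tight_path n c ->
  4 * m * a + 2 * m < N ->
  exists v (X : {set 'I_N}), 2 * m <= #|X| /\
    {in X, forall x : 'I_N, x <= 4 * m * a + 2 * m /\ ends_blue_path c a v x}.
Proof.
move=> Rm m0 noRed noBlue; elim: a => [|a IHa] ltN.
  have N0 : 0 < N by lia.
  (* Start from vertex 0 and the [2 * m] vertices after it. *)
  exists (Ordinal N0), [set x : 'I_N | 1 <= x < (2 * m).+1]; split.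
    by rewrite card_ord_interval; lia.
  by move=> x; rewrite inE /= => /andP[x0 lex]; split; [lia|exact: x0].
have [|v [X [leX vX]]] := IHa; first by lia.
(* [s] is the first vertex beyond the bound on [X]; the next block consists of the [4 * m] vertices
   from [s] on. *)
pose s := (4 * m * a + 2 * m).+1.
have [||x|x xX leB] := blue_path_extension
  (B := [set w : 'I_N | s <= w < s + 4 * m]) (v := v) (a := a)
  Rm m0 noRed noBlue leX.
- by rewrite card_ord_interval; lia.
- by move=> x w /vX[lex _]; rewrite inE /s; lia.
- by case/vX.
exists x; eexists; split; first exact: leB.
by move=> w; rewrite !inE /s => /andP[ltw xw]; split=> //; lia.
Qed.

Theorem theorem6 (n : nat) (hn : 2 <= n) :
  exists N m : nat,
    [/\ is_r3 4 n N, is_r_path_square n m & N < 6 * n * m].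
Proof.
have [m minm] : exists m, is_r_path_square n m.
  exact/is_minimum_exists/mono_path_square_exists.
have Rm : forall c : {set 'I_m} -> bool, mono_path_square n c by case: minm.
have m_gt0 : 0 < m.
  have [_ [x _]] := Rm (fun=> true); have n0 : 0 < n by lia.
  by have := ltn_ord (x (Ordinal n0)); lia.
pose M := (6 * n * m).-1.
have bound (c : {set 'I_M} -> bool) : red_clique3 4 c \/ blue_tight_path n c.
  case: (classic (red_clique3 4 c)) => [|noRed]; first by left.
  right; apply: NNPP => noBlue.
  (* Height [n - 2] means a path on [n] vertices; the construction uses
     [4 * m * (n - 2) + 2 * m + 1] vertices, at most [M]. *)
  have [|v [X [leX vX]]] := long_blue_paths (a := n - 2) Rm m_gt0 noRed noBlue.
    by rewrite /M; nia.
  have /card_gt0P[x /vX[_ /ends_blue_path_tight]] : 0 < #|X| by lia.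
  by rewrite -addn2 subnK.
have [N minN] : exists N, is_r3 4 n N by apply: is_minimum_exists; exists M.
exists N, m; split=> //.
have [_ /(_ M bound) leNM] := minN.
by apply: leq_ltn_trans leNM _; rewrite /M; nia.
Qed.
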